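(* Let $\mathbb{K}$ be an algebraically closed field of characteristic $0$ and let $\alpha,\alpha',\gamma,\gamma'\in\mathbb{K}$. The down-up algebras $A(\alpha,0,\gamma)$ and $A(\alpha',0,\gamma')$ are isomorphic as $\mathbb{K}$-algebras if and only if (1) $\gamma=\lambda\gamma'$ for some $\lambda\in\mathbb{K}^\times$ (equivalently, $\gamma$ and $\gamma'$ are both zero or both nonzero), and (2) $\alpha'=\alpha$.
   Context: For $(\alpha,\beta,\gamma)\in\mathbb{K}^3$, the down-up algebra $A(\alpha,\beta,\gamma)$ is the quotient of the free associative algebra $\mathbb{K}\langle d,u\rangle$ by the two-sided ideal generated by $d^2u-(\alpha dud+\beta ud^2+\gamma d)$ and $du^2-(\alpha udu+\beta u^2d+\gamma u)$. *)

(* Defs.v *)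
From HB Require Import structures.
From mathcomp Require Import all_boot all_order all_algebra.
Set Implicit Arguments. Unset Strict Implicit. Unset Printing Implicit Defensive.
Import GRing.Theory.
Local Open Scope ring_scope.

(* Noncommutative polynomial expressions in the two generators d, u with
   coefficients in K: these are (representatives of) elements of the free
   associative algebra K<d,u>. *)
Inductive dterm (K : Type) : Type :=
  | Tc of K
  | Td | Tu
  | Tadd of dterm K & dterm K
  | Tmul of dterm K & dterm K.
Arguments Td {K}. Arguments Tu {K}.

Fixpoint deval (K : fieldType) (R : algType K) (x y : R) (t : dterm K) : R :=
  match t with
  | Tc c => c%:A
  | Td => x
  | Tu => y
  | Tadd s t => deval x y s + deval x y t
  | Tmul s t => deval x y s * deval x y t
  end.

Definition downup_rel (K : fieldType) (R : algType K) (a b g : K) (x y : R) : Prop :=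
  x * x * y = a *: (x * y * x) + b *: (y * x * x) + g *: x /\
  x * y * y = a *: (y * x * y) + b *: (y * y * x) + g *: y.

(* The down-up algebra A(a,b,g) = K<d,u>/I, with I generated by the two
   relations.  Two expressions s, t represent the same element of A(a,b,g)
   iff they agree under every algebra map K<d,u> -> R that kills I, i.e. at
   every pair (x,y) in every K-algebra R satisfying the relations
   (A(a,b,g) itself being one such R, this is exactly equality mod I). *)
Definition downup_eq (K : fieldType) (a b g : K) (s t : dterm K) : Prop :=
  forall (R : algType K) (x y : R), downup_rel a b g x y -> deval x y s = deval x y t.

(* A K-algebra homomorphism A(a,b,g) -> A(a',b',g') is determined by the
   images D, U of d, u (expressions in A(a',b',g')); it is well defined iff
   (D, U) satisfies the relations of A(a,b,g) inside A(a',b',g'), i.e. at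
   every realisation (x,y) of A(a',b',g'). *)
Definition downup_hom (K : fieldType) (a b g a' b' g' : K) (D U : dterm K) : Prop :=
  forall (R : algType K) (x y : R),
    downup_rel a' b' g' x y -> downup_rel a b g (deval x y D) (deval x y U).

(* A(a,b,g) and A(a',b',g') are isomorphic as K-algebras: there are algebra
   maps phi : A -> A' (d |-> D, u |-> U) and psi : A' -> A (d |-> D', u |-> U')
   with psi o phi = id and phi o psi = id (checked on the generators). *)
Definition downup_iso (K : fieldType) (a b g a' b' g' : K) : Prop :=
  exists D U D' U' : dterm K,
    [/\ downup_hom a b g a' b' g' D U,
        downup_hom a' b' g' a b g D' U',
        (forall (R : algType K) (x y : R), downup_rel a b g x y ->
           deval (deval x y D') (deval x y U') D = x /\
           deval (deval x y D') (deval x y U') U = y) &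
        (forall (R : algType K) (x y : R), downup_rel a' b' g' x y ->
           deval (deval x y D) (deval x y U) D' = x /\
           deval (deval x y D) (deval x y U) U' = y)].

(* Main.v *)
Require Import Defs.
From HB Require Import structures.
From mathcomp Require Import all_boot all_order all_algebra.
From mathcomp.classical Require Import boolp.
From mathcomp Require Import ring zify.
Import GRing.Theory.
Local Open Scope ring_scope.

(* With w = du - a ud - g, the relations of A(a, 0, g) are d w = 0 and w u = 0, so
   its one-dimensional representations are the origin and the conic (1 - a) x y = g:
   this separates g = 0 from g <> 0 and a = 1 from a <> 1.
   If g = 0 and a <> 1, the isomorphism fixes the crossing point of the two axes, and
   its linear part, tested on strictly upper triangular 4 x 4 matrices, preserves the
   cubic relations; this forces it to be diagonal and a' = a.
   If g <> 0 and a <> 1, the isomorphism acts on the hyperbola by u |-> mu u or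
   u |-> mu / u.  In the first case a is read off from the non-split extensions
   between points of the hyperbola.  The second case is excluded by a Fredholm index
   argument in the Toeplitz representation u p = X p, d p = c (p - p(0)) / X on K[X],
   where d u = c for c = g / (1 - a). *)

(** * One-dimensional representations *)

Lemma deval_morph (K : fieldType) (R S : algType K) (f : {rmorphism R -> S})
    (fA : forall c, f c%:A = c%:A) (x y : R) (t : dterm K) :
  f (deval x y t) = deval (f x) (f y) t.
Proof.
by elim: t => [c|||s IHs t IHt|s IHs t IHt] //=; rewrite ?rmorphD ?rmorphM IHs IHt.
Qed.

Lemma horner_deval (K : fieldType) (p q : {poly K}) (t : dterm K) (x : K) :
  (deval p q t).[x] = deval (p.[x] : K^o) q.[x] t.
Proof.
have fA c : horner_eval x (c%:A : {poly K}) = (c%:A : K^o).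
  by rewrite /horner_eval hornerZ hornerC.
exact: (@deval_morph K {poly K} K^o (horner_eval x) fA).
Qed.

Lemma downup_iso_sym (K : fieldType) (a b g a' b' g' : K) :
  downup_iso a b g a' b' g' -> downup_iso a' b' g' a b g.
Proof. by case=> D [U [D' [U' [h1 h2 h3 h4]]]]; exists D', U', D, U. Qed.

(* Over a commutative algebra both relations with [b = 0] are multiples of
   [w = (1 - a) x y - g]. *)
Lemma downup_rel_comm (K : fieldType) (R : comAlgType K) (a g : K) (x y : R) :
  downup_rel a 0 g x y <->
  x * ((1 - a) *: (x * y) - g%:A) = 0 /\ y * ((1 - a) *: (x * y) - g%:A) = 0.
Proof.
rewrite /downup_rel !scale0r !addr0 !mulrBr -!scalerAr !mulr1 !scalerBl !scale1r.
rewrite !mulrA (mulrC y x) (mulrAC x y x).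
by split=> -[/eqP h1 /eqP h2]; split; apply/eqP; move: h1 h2;
  rewrite -!addrA -!opprD !subr_eq0.
Qed.

Lemma downup_rel_scal (K : fieldType) (a g x y : K) :
  downup_rel (R := K^o) a 0 g x y <->
  x * ((1 - a) * (x * y) - g) = 0 /\ y * ((1 - a) * (x * y) - g) = 0.
Proof. by rewrite downup_rel_comm [g%:A]mulr1. Qed.

Lemma downup_rel_origin (K : fieldType) (R : algType K) (a b g : K) :
  downup_rel (R := R) a b g 0 0.
Proof. by split; rewrite !mul0r !scaler0 !addr0. Qed.

Lemma downup_rel_hyperbola (K : fieldType) (a g x : K) (a1 : a != 1) (x0 : x != 0) :
  downup_rel (R := K^o) a 0 g (g / (1 - a) / x) x.
Proof.
have a1' : 1 - a != 0 by rewrite subr_eq0 eq_sym.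
have e : (1 - a) * (g / (1 - a) / x * x) - g = 0 by rewrite divfK // mulrC divfK // subrr.
by apply/downup_rel_scal; rewrite e !mulr0.
Qed.

(** With [g = 0] the one-dimensional representations form a cone, so the line joining one of them to
    the origin is a representation over the domain [{poly K}]. *)
Lemma downup_rel_cone (K : fieldType) (a x y : K) :
  downup_rel (R := K^o) a 0 0 x y -> downup_rel (R := {poly K}) a 0 0 (x *: 'X) (y *: 'X).
Proof.
move=> /downup_rel_scal; rewrite subr0 => -[e1 e2].
have e : (1 - a) *: (x *: 'X * (y *: 'X)) - 0%:A = ((1 - a) * (x * y)) *: ('X * 'X) :> {poly K}.
  by rewrite scale0r subr0 -scalerAl -scalerAr !scalerA mulrA.
by apply/downup_rel_comm; rewrite e -!scalerAl -!scalerAr !scalerA e1 e2 !scale0r.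
Qed.

Lemma horner_deval_line (K : fieldType) (x y s : K) (t : dterm K) :
  (deval (x *: 'X) (y *: 'X) t).[s] = deval (s * x : K^o) (s * y) t.
Proof. by rewrite horner_deval !hornerZ hornerX ![_ * s]mulrC. Qed.

(** If [g] were nonzero, the origin would be an isolated one-dimensional representation of
    [A(a, 0, g)], while those of [A(a', 0, 0)] form a connected cone with more than one point. *)
Lemma iso_gamma0 (K : fieldType) (a a' g g' : K) :
  downup_iso a 0 g a' 0 g' -> g' = 0 -> g = 0.
Proof.
move=> [D [U [D' [U' [h h' hK h'K]]]]] g'0; subst g'.
apply/eqP; apply/negP => /negP g0.
(* Here the origin is the only representation of [A(a, 0, g)], so [(0, 0)] and [(1, 0)] get the same
   image and [D'] cannot tell them apart. *)
have [a1|a1] := eqVneq a 1.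
  have z x y : downup_rel (R := K^o) a 0 g x y -> x = 0 /\ y = 0.
    move/downup_rel_scal; rewrite a1 subrr mul0r sub0r => -[/eqP + /eqP].
    by rewrite !mulf_eq0 !oppr_eq0 (negPf g0) !orbF => /eqP -> /eqP ->.
  have r1 : downup_rel (R := K^o) a' 0 0 1 0.
    by apply/downup_rel_scal; rewrite !mulr0 subr0 !mulr0.
  have [/= e1 e2] := z _ _ (h _ _ _ r1).
  have [/= e3 e4] := z _ _ (h _ _ _ (downup_rel_origin K K^o a' 0 0)).
  have [/= e5 _] := h'K _ _ _ r1.
  have [/= e6 _] := h'K _ _ _ (downup_rel_origin K K^o a' 0 0).
  by move/eqP: (oner_neq0 K); apply; rewrite -[LHS]e5 -[RHS]e6 e1 e2 e3 e4.
have a1' : 1 - a != 0 by rewrite subr_eq0 eq_sym.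
(* On the line through [(x, y)], either [D] vanishes identically or [(1 - a) D U = g], and then [D]
   has no zero. All these lines meet at the origin, so [D] vanishes everywhere on the cone or
   nowhere; the points coming from the origin and from the hyperbola contradict this. *)
have conn (x y : K) : downup_rel (R := K^o) a' 0 0 x y ->
    (deval (x : K^o) y D == 0) = (deval (0 : K^o) 0 D == 0).
  move=> /downup_rel_cone /h /downup_rel_comm [/eqP + _].
  rewrite mulf_eq0 => /orP [] /eqP e.
    have e' s : deval (s * x : K^o) (s * y) D = 0 by rewrite -horner_deval_line e horner0.
    by have := e' 1; have := e' 0; rewrite !mul0r !mul1r => -> ->; rewrite eqxx.
  have e' s : deval (s * x : K^o) (s * y) D != 0.
    apply: contra_neq g0 => e0; move/(congr1 (fun p => p.[s])): e.
    rewrite hornerD hornerN !hornerZ hornerM hornerC mulr1 horner_deval_line [deval _ _ D]e0 mul0r mulr0.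
    by rewrite horner0 sub0r => /eqP; rewrite oppr_eq0 => /eqP.
  by have := e' 1; have := e' 0; rewrite !mul0r !mul1r => /negPf -> /negPf ->.
have r0 := downup_rel_origin K K^o a 0 g.
have r1 := @downup_rel_hyperbola K a g (g / (1 - a)) a1 _.
have {}r1 := r1 (mulf_neq0 g0 (invr_neq0 a1')).
have /conn := h' _ _ _ r0; have /conn := h' _ _ _ r1.
have [-> _] := hK _ _ _ r0; have [-> _] := hK _ _ _ r1.
by move=> <-; rewrite eqxx mulf_eq0 invr_eq0 orbb (negPf (mulf_neq0 g0 (invr_neq0 a1'))).
Qed.

(** For [a' = 1] the representations fill the plane; for [a <> 1] they form two axes, a reducible
    variety. The line joining the points sent to [(1, 0)] and [(0, 1)] would have to map into a
    single axis. *)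
Lemma iso_alpha1_gamma0 (K : fieldType) (a a' : K) :
  downup_iso a 0 0 a' 0 0 -> a' = 1 -> a = 1.
Proof.
move=> [D [U [D' [U' [h h' hK h'K]]]]] a'1; subst a'.
apply/eqP; apply/negP => /negP a1.
have a1' : 1 - a != 0 by rewrite subr_eq0 eq_sym.
have all_rel (R : comAlgType K) (x y : R) : downup_rel 1 0 0 x y.
  by apply/downup_rel_comm; rewrite subrr !scale0r subrr !mulr0.
have r1 : downup_rel (R := K^o) a 0 0 1 0.
  by apply/downup_rel_scal; rewrite !mulr0 subr0 !mulr0.
have r2 : downup_rel (R := K^o) a 0 0 0 1.
  by apply/downup_rel_scal; rewrite !mul0r mulr0 subr0 !mulr0.
have [/= e1 _] := hK _ _ _ r1; have [/= _ e2] := hK _ _ _ r2.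
set p1 := deval (1 : K^o) 0 D' in e1 *; set p2 := deval (1 : K^o) 0 U' in e1 *.
set q1 := deval (0 : K^o) 1 D' in e2 *; set q2 := deval (0 : K^o) 1 U' in e2 *.
pose lx : {poly K} := p1%:P + (q1 - p1) *: 'X.
pose ly : {poly K} := p2%:P + (q2 - p2) *: 'X.
have ev0 t : (deval lx ly t).[0] = deval p1 p2 t.
  by rewrite horner_deval !hornerD !hornerZ !hornerC !hornerX !mulr0 !addr0.
have ev1 t : (deval lx ly t).[1] = deval q1 q2 t.
  by rewrite horner_deval !hornerD !hornerZ !hornerC !hornerX !mulr1 !subrKC.
have /h /downup_rel_comm [/eqP] := all_rel _ lx ly.
rewrite scale0r subr0 mulf_eq0 => + /eqP; rewrite mulf_eq0.
rewrite -!mul_polyC !mulf_eq0 polyC_eq0 (negPf a1') /= => /orP [/eqP e _|].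
  by move: e1; rewrite -ev0 e horner0 => /eqP; rewrite eq_sym oner_eq0.
case/orP=> [] /eqP e _.
  by move: e1; rewrite -ev0 e horner0 => /eqP; rewrite eq_sym oner_eq0.
by move: e2; rewrite -ev1 e horner0 => /eqP; rewrite eq_sym oner_eq0.
Qed.

(** For [a' = 1] only the origin is left, whereas for [a <> 1] the curve [(1 - a) x y = g] has a
    point with [y = 1], even when [g = 0]. *)
Lemma iso_alpha1_gamma_neq0 (K : fieldType) (a a' g g' : K) :
  g' != 0 -> downup_iso a 0 g a' 0 g' -> a' = 1 -> a = 1.
Proof.
move=> g'0 [D [U [D' [U' [h h' hK h'K]]]]] a'1; subst a'.
apply/eqP; apply/negP => /negP a1.
have z x y : downup_rel (R := K^o) 1 0 g' x y -> x = 0 /\ y = 0.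
  move/downup_rel_scal; rewrite subrr mul0r sub0r => -[/eqP + /eqP].
  by rewrite !mulf_eq0 !oppr_eq0 (negPf g'0) !orbF => /eqP -> /eqP ->.
have r1 := @downup_rel_hyperbola K a g 1 a1 (oner_neq0 K).
have [/= e1 e2] := z _ _ (h' _ _ _ r1).
have [/= e3 e4] := z _ _ (h' _ _ _ (downup_rel_origin K K^o a 0 g)).
have [/= _ e5] := hK _ _ _ r1.
have [/= _ e6] := hK _ _ _ (downup_rel_origin K K^o a 0 g).
by move/eqP: (oner_neq0 K); apply; rewrite -[LHS]e5 -[RHS]e6 e1 e2 e3 e4.
Qed.

(** * Strictly triangular representations *)

(** The filtration by superdiagonals: depth 0 is upper triangular, depth 1 strictly upper
    triangular. *)
Definition depth (K : fieldType) (n : nat) (m : nat) (M : 'M[K]_n) :=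
  forall i j : 'I_n, (j < i + m)%N -> M i j = 0.

Lemma depth_mul (K : fieldType) (n m1 m2 : nat) (M N : 'M[K]_n) :
  depth K n m1 M -> depth K n m2 N -> depth K n (m1 + m2) (M *m N).
Proof.
move=> hM hN i j ij; rewrite mxE big1 // => k _.
have [ik|ik] := ltnP k (i + m1); first by rewrite hM // mul0r.
by rewrite hN ?mulr0 //; apply: leq_trans ij _; rewrite addnA leq_add2r.
Qed.

(** On the leading superdiagonal of a product only one middle index survives in the sum. *)
Lemma depth_mulE (K : fieldType) (n m1 m2 : nat) (M N : 'M[K]_n) (i k j : 'I_n) :
  depth K n m1 M -> depth K n m2 N -> k = (i + m1)%N :> nat -> j = (k + m2)%N :> nat ->
  (M *m N) i j = M i k * N k j.
Proof.
move=> hM hN ik kj; rewrite mxE (bigD1 k) //= big1 ?addr0 // => l lk.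
have [il|il] := ltnP l (i + m1); first by rewrite hM // mul0r.
rewrite hN ?mulr0 // kj ltn_add2r ltn_neqAle [in X in _ && X]ik il andbT.
by rewrite eq_sym.
Qed.

Lemma depthW (K : fieldType) (n m1 m2 : nat) (M : 'M[K]_n) :
  (m1 <= m2)%N -> depth K n m2 M -> depth K n m1 M.
Proof.
by move=> m12 hM i j ij; apply: hM; apply: leq_trans ij _; rewrite leq_add2l.
Qed.

Lemma depthD (K : fieldType) (n m : nat) (M N : 'M[K]_n) :
  depth K n m M -> depth K n m N -> depth K n m (M + N).
Proof. by move=> hM hN i j ij; rewrite mxE hM // hN // addr0. Qed.

Lemma depthZ (K : fieldType) (n m : nat) (c : K) (M : 'M[K]_n) :
  depth K n m M -> depth K n m (c *: M).
Proof. by move=> hM i j ij; rewrite mxE hM // mulr0. Qed.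

Lemma depth_scalar (K : fieldType) (n : nat) (c : K) : depth K n 0 c%:M.
Proof.
by move=> i j; rewrite addn0 => ji; rewrite mxE eq_sym -val_eqE ltn_eqF.
Qed.

Lemma deval_depth0 (K : fieldType) (n : nat) (x y : 'M[K]_n.+1) (t : dterm K) :
  depth K _ 0 x -> depth K _ 0 y ->
  depth K _ 0 (deval x y t) /\
  forall i, deval x y t i i = deval (x i i : K^o) (y i i) t.
Proof.
move=> hx hy; elim: t => [c|||s [IHs es] t [IHt et]|s [IHs es] t [IHt et]] //=.
- by split=> [|i]; rewrite -?scalemx1; [exact/depthZ/depth_scalar | rewrite !mxE eqxx].
- by split=> [|i]; [exact: depthD | rewrite mxE es et].
- split=> [|i]; first exact: depth_mul IHs IHt.
  by rewrite (depth_mulE K _ 0 0 _ _ i i i IHs IHt) ?addn0 // es et.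
Qed.

(* The linear part of [t], evaluated at [(p, q)]. *)
Fixpoint dlin (K : fieldType) (p q : K) (t : dterm K) : K :=
  match t with
  | Tc _ => 0
  | Td => p
  | Tu => q
  | Tadd s t => dlin K p q s + dlin K p q t
  | Tmul s t => dlin K p q s * deval (0 : K^o) 0 t + deval (0 : K^o) 0 s * dlin K p q t
  end.

Lemma dlinE (K : fieldType) (p q : K) (t : dterm K) :
  dlin K p q t = dlin K 1 0 t * p + dlin K 0 1 t * q.
Proof.
elim: t => [c|||s IHs t IHt|s IHs t IHt] /=.
- by rewrite !mul0r addr0.
- by rewrite mul1r mul0r addr0.
- by rewrite mul1r mul0r add0r.
- rewrite IHs IHt; ring.
- rewrite IHs IHt; ring.
Qed.

(** A product of two strictly triangular remainders starts on the second superdiagonal, so the first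
    one sees only the linear part. *)
Lemma deval_depth1 (K : fieldType) (n : nat) (x y : 'M[K]_n.+1) (t : dterm K) :
  depth K _ 1 x -> depth K _ 1 y ->
  depth K _ 1 (deval x y t - (deval (0 : K^o) 0 t)%:M) /\
  forall i j : 'I_n.+1, j = (i + 1)%N :> nat ->
    deval x y t i j = dlin K (x i j) (y i j) t.
Proof.
move=> hx hy.
suff [r [hr er ->]] : exists r, [/\ depth K _ 1 r,
    forall i j : 'I_n.+1, j = (i + 1)%N :> nat -> r i j = dlin K (x i j) (y i j) t
    & deval x y t = (deval (0 : K^o) 0 t)%:M + r].
  split=> [|i j ij]; first by rewrite addrC addKr.
  have /negPf ne : i != j by rewrite -val_eqE /= ij addn1 neq_ltn ltnSn.
  by rewrite !mxE er // ne add0r.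
elim: t => [c|||s [r [hr er es]] t [r' [hr' er' et]]|s [r [hr er es]] t [r' [hr' er' et]]] /=.
- exists 0; split=> [i j _|i j _|]; rewrite ?mxE //.
  by rewrite addr0 -scalemx1 [c%:A in RHS]mulr1.
- by exists x; split=> //; rewrite raddf0 add0r.
- by exists y; split=> //; rewrite raddf0 add0r.
- exists (r + r'); split; first exact: depthD.
    by move=> i j ij; rewrite mxE er // er'.
  by rewrite es et raddfD addrACA.
- set s0 := deval _ _ s; set t0 := deval _ _ t.
  exists (s0 *: r' + t0 *: r + r *m r'); split.
  + apply: depthD; first by apply: depthD; exact: depthZ.
    exact: (depthW K _ _ 2 _ _ (depth_mul K _ _ _ _ _ hr hr')).
  + move=> i j ij.
    rewrite !mxE er // er' //.
    have := depth_mul K _ _ _ _ _ hr hr' i j; rewrite mxE ij => -> //.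
      by rewrite addr0 addrC mulrC.
    by rewrite ltn_add2l.
  + rewrite es et -[_ * _]/(_ *m _) mulmxDl !mulmxDr scalar_mxM.
    by rewrite !mul_scalar_mx mul_mx_scalar !addrA.
Qed.

(** A product of three strictly upper triangular matrices of size 4 is supported in the top right
    corner, so each cubic relation becomes one scalar equation. *)
Lemma mx4_rel (K : fieldType) (a : K) (x y : 'M[K]_4) (i0 i1 i2 i3 : 'I_4) :
  i0 = 0%N :> nat -> i1 = 1%N :> nat -> i2 = 2%N :> nat -> i3 = 3%N :> nat ->
  depth K _ 1 x -> depth K _ 1 y ->
  downup_rel a 0 0 x y <->
  x i0 i1 * x i1 i2 * y i2 i3 = a * (x i0 i1 * y i1 i2 * x i2 i3) /\
  x i0 i1 * y i1 i2 * y i2 i3 = a * (y i0 i1 * x i1 i2 * y i2 i3).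
Proof.
move=> v0 v1 v2 v3 hx hy; rewrite /downup_rel !scale0r !addr0.
have d3 (p q r : 'M[K]_4) : depth K _ 1 p -> depth K _ 1 q -> depth K _ 1 r ->
    depth K _ 3 (p *m q *m r) /\ (p *m q *m r) i0 i3 = p i0 i1 * q i1 i2 * r i2 i3.
  move=> hp hq hr; have hpq := depth_mul K _ _ _ _ _ hp hq.
  split; first exact: depth_mul K _ _ _ _ _ hpq hr.
  by rewrite (depth_mulE K _ _ _ _ _ i0 i2 i3 hpq hr) ?v0 ?v2 ?v3 //
    (depth_mulE K _ _ _ _ _ i0 i1 i2 hp hq) ?v0 ?v1 ?v2.
have eq3 (p q : 'M[K]_4) : depth K _ 3 p -> depth K _ 3 q -> p = a *: q <-> p i0 i3 = a * q i0 i3.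
  move=> hp hq; split=> [->|e]; first by rewrite mxE.
  apply/matrixP => i j; rewrite mxE.
  have [ij|ij] := ltnP j (i + 3); first by rewrite hp // hq // mulr0.
  have [-> -> //] : i = i0 /\ j = i3.
  have := ltn_ord i; have := ltn_ord j.
  by split; apply: val_inj; rewrite /= ?v0 ?v3; lia.
have [dxxy exxy] := d3 _ _ _ hx hx hy; have [dxyx exyx] := d3 _ _ _ hx hy hx.
have [dxyy exyy] := d3 _ _ _ hx hy hy; have [dyxy eyxy] := d3 _ _ _ hy hx hy.
rewrite -exxy -exyx -exyy -eyxy.
by have := eq3 _ _ dxxy dxyx; have := eq3 _ _ dxyy dyxy; tauto.
Qed.

(** A pair of such matrices carries three independent points [(x i, y i)]; on them a cubic relation
    is evaluated as a trilinear form, one point per letter of a word. *)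
Definition superdiag (K : fieldType) (x : nat -> K) : 'M[K]_4 :=
  \matrix_(i, j) if j == (i + 1)%N :> nat then x i else 0.

Lemma superdiag_depth (K : fieldType) (x : nat -> K) : depth K _ 1 (superdiag K x).
Proof. by move=> i j ij; rewrite mxE ltn_eqF. Qed.

Lemma superdiag_rel (K : fieldType) (a : K) (x y : nat -> K) :
  downup_rel a 0 0 (superdiag K x) (superdiag K y) <->
  x 0%N * x 1%N * y 2%N = a * (x 0%N * y 1%N * x 2%N) /\
  x 0%N * y 1%N * y 2%N = a * (y 0%N * x 1%N * y 2%N).
Proof.
rewrite (mx4_rel K a _ _ (inord 0) (inord 1) (inord 2) (inord 3)) ?inordK //;
  try exact: superdiag_depth.
by rewrite !mxE !inordK.
Qed.

Lemma deval_superdiag_rel (K : fieldType) (a : K) (x y : nat -> K) (s t : dterm K) :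
  deval (0 : K^o) 0 s = 0 -> deval (0 : K^o) 0 t = 0 ->
  let p i := dlin K (x i) (y i) s in let q i := dlin K (x i) (y i) t in
  downup_rel a 0 0 (deval (superdiag K x) (superdiag K y) s)
    (deval (superdiag K x) (superdiag K y) t) <->
  p 0%N * p 1%N * q 2%N = a * (p 0%N * q 1%N * p 2%N) /\
  p 0%N * q 1%N * q 2%N = a * (q 0%N * p 1%N * q 2%N).
Proof.
move=> s0 t0 p q.
have [ds es] := deval_depth1 K _ _ _ s (superdiag_depth K x) (superdiag_depth K y).
have [dt et] := deval_depth1 K _ _ _ t (superdiag_depth K x) (superdiag_depth K y).
rewrite s0 raddf0 subr0 in ds; rewrite t0 raddf0 subr0 in dt.
rewrite (mx4_rel K a _ _ (inord 0) (inord 1) (inord 2) (inord 3)) ?inordK //.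
by rewrite !es ?et ?inordK // !mxE !inordK.
Qed.

(** On the line from the origin to the point sent to [(0, 1)], [D] or [U] vanishes identically; [U]
    is 1 at the far end, so it is [D], and [D] is 0 at the origin. The point sent to [(1, 0)] gives
    the same for [U]. *)
Lemma iso_origin (K : fieldType) (a a' : K) (D U D' U' : dterm K) : a != 1 ->
  downup_hom a 0 0 a' 0 0 D U -> downup_hom a' 0 0 a 0 0 D' U' ->
  (forall (R : algType K) (x y : R), downup_rel a 0 0 x y ->
     deval (deval x y D') (deval x y U') D = x /\
     deval (deval x y D') (deval x y U') U = y) ->
  deval (0 : K^o) 0 D = 0 /\ deval (0 : K^o) 0 U = 0.
Proof.
move=> a1 h h' hK; have a1' : 1 - a != 0 by rewrite subr_eq0 eq_sym.
have dom (x y : K) : downup_rel (R := K^o) a' 0 0 x y ->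
    deval (x *: 'X) (y *: 'X) D = 0 \/ deval (x *: 'X) (y *: 'X) U = 0.
  move=> /downup_rel_cone /h /downup_rel_comm [/eqP + _].
  rewrite scale0r subr0 -!mul_polyC !mulf_eq0 polyC_eq0 (negPf a1') /=.
  by case/or3P=> /eqP ->; [left|left|right].
have ev0 (x y : K) t : (deval (x *: 'X) (y *: 'X) t).[0] = deval (0 : K^o) 0 t.
  by rewrite horner_deval_line !mul0r.
have ev1 (x y : K) t : (deval (x *: 'X) (y *: 'X) t).[1] = deval (x : K^o) y t.
  by rewrite horner_deval_line !mul1r.
have r1 : downup_rel (R := K^o) a 0 0 1 0.
  by apply/downup_rel_scal; rewrite !mulr0 subr0 !mulr0.
have r2 : downup_rel (R := K^o) a 0 0 0 1.
  by apply/downup_rel_scal; rewrite !mul0r mulr0 subr0 !mulr0.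
have [e1 _] := hK _ _ _ r1; have [_ e2] := hK _ _ _ r2.
split; apply/eqP.
  case: (dom _ _ (h' _ _ _ r2)) => e.
    by move/(congr1 (fun p => p.[0])): e; rewrite ev0 horner0 => ->.
  by move/eqP: (oner_neq0 K); case; rewrite -[LHS]e2 -ev1 e horner0.
case: (dom _ _ (h' _ _ _ r1)) => e; last first.
    by move/(congr1 (fun p => p.[0])): e; rewrite ev0 horner0 => ->.
by move/eqP: (oner_neq0 K); case; rewrite -[LHS]e1 -ev1 e horner0.
Qed.

Lemma iso_alpha_gamma0 (K : fieldType) (a a' : K) :
  a != 1 -> a' != 1 -> downup_iso a 0 0 a' 0 0 -> a' = a.
Proof.
move=> a1 a1' [D [U [D' [U' [h h' hK h'K]]]]].
have [D0 U0] := iso_origin K _ _ _ _ _ _ a1 h h' hK.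
have [D0' U0'] := iso_origin K _ _ _ _ _ _ a1' h' h h'K.
have lin (x y : nat -> K) :
    x 0%N * x 1%N * y 2%N = a' * (x 0%N * y 1%N * x 2%N) ->
    x 0%N * y 1%N * y 2%N = a' * (y 0%N * x 1%N * y 2%N) ->
    let p i := dlin K (x i) (y i) D in let q i := dlin K (x i) (y i) U in
    p 0%N * p 1%N * q 2%N = a * (p 0%N * q 1%N * p 2%N) /\
    p 0%N * q 1%N * q 2%N = a * (q 0%N * p 1%N * q 2%N).
  by move=> e1 e2; apply/(deval_superdiag_rel K a x y D U D0 U0)/h/superdiag_rel.
(* The linear parts are mutually inverse: with a single nonzero superdiagonal entry every cubic word
   vanishes, so any [(x, y)] is allowed. *)
have inv (x y : K) : dlin K (dlin K x y D) (dlin K x y U) D' = x /\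
    dlin K (dlin K x y D) (dlin K x y U) U' = y.
  pose X := superdiag K (fun i => x *+ (i == 0)); pose Y := superdiag K (fun i => y *+ (i == 0)).
  have [|eX eY] := h'K _ X Y.
    by apply/superdiag_rel; rewrite /= !mulr0n !(mulr0, mul0r).
  have dX := superdiag_depth K (fun i => x *+ (i == 0)).
  have dY := superdiag_depth K (fun i => y *+ (i == 0)).
  have [dD eD] := deval_depth1 K _ _ _ D dX dY; have [dU eU] := deval_depth1 K _ _ _ U dX dY.
  rewrite D0 raddf0 subr0 in dD; rewrite U0 raddf0 subr0 in dU.
  have [_ eD'] := deval_depth1 K _ _ _ D' dD dU.
  have [_ eU'] := deval_depth1 K _ _ _ U' dD dU.
  have i01 : (inord 1 : 'I_4) = ((inord 0 : 'I_4) + 1)%N :> nat by rewrite !inordK.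
  move: (eD' (inord 0 : 'I_4) (inord 1) i01) (eU' (inord 0 : 'I_4) (inord 1) i01).
  by rewrite -/X -/Y eX eY (eD _ _ i01) (eU _ _ i01) !mxE !inordK.
have [d1 [d2 linD]] : exists d1 d2, forall p q, dlin K p q D = d1 * p + d2 * q.
  by exists (dlin K 1 0 D), (dlin K 0 1 D) => p q; exact: dlinE.
have [u1 [u2 linU]] : exists u1 u2, forall p q, dlin K p q U = u1 * p + u2 * q.
  by exists (dlin K 1 0 U), (dlin K 0 1 U) => p q; exact: dlinE.
have {}lin (x y : nat -> K) :
    x 0%N * x 1%N * y 2%N = a' * (x 0%N * y 1%N * x 2%N) ->
    x 0%N * y 1%N * y 2%N = a' * (y 0%N * x 1%N * y 2%N) ->
    let p i := d1 * x i + d2 * y i in let q i := u1 * x i + u2 * y i in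
    p 0%N * p 1%N * q 2%N = a * (p 0%N * q 1%N * p 2%N).
  by move=> e1 e2; have [] := lin x y e1 e2; rewrite !linD !linU.
have kill (p q : K) : p * p * q = a * (p * q * p) -> p = 0 \/ q = 0.
  move=> e; have : (1 - a) * (p * (p * q)) = 0.
    by rewrite mulrBl mul1r mulrA {1}e mulrAC subrr.
  move/eqP; rewrite !mulf_eq0 subr_eq0 eq_sym (negPf a1) /=.
  by case/or3P => /eqP; tauto.
have du1 : d1 = 0 \/ u1 = 0.
  apply: kill; have := lin (fun=> 1) (fun=> 0); rewrite !(mulr0, mul0r, mulr1, addr0).
  exact.
have du2 : d2 = 0 \/ u2 = 0.
  apply: kill; have := lin (fun=> 0) (fun=> 1); rewrite !(mulr0, mul0r, mulr1, add0r).
  exact.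
have det0 : d1 * u2 - d2 * u1 != 0.
  apply/eqP => e.
  have z : dlin K 0 0 D' = 0 /\ dlin K 0 0 U' = 0 by rewrite (dlinE K 0 0 D') (dlinE K 0 0 U') !mulr0 addr0.
  have ker x y : d1 * x + d2 * y = 0 -> u1 * x + u2 * y = 0 -> x = 0 /\ y = 0.
    move=> e1 e2; have := inv x y; rewrite linD linU e1 e2.
    by case: z => -> -> [<- <-].
  (* If the determinant vanishes, the columns of the adjugate lie in the kernel, so the matrix is
     zero and kills [(1, 0)]. *)
  have [u20 u10] : u2 = 0 /\ - u1 = 0 by apply: ker; [rewrite mulrN | ring].
  have [d20 d10] : - d2 = 0 /\ d1 = 0 by apply: ker; [ring | rewrite -[RHS]e; ring].
  have [|| /eqP] := ker 1 0; last by rewrite oner_eq0.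
    by rewrite d10 mul0r mulr0 addr0.
  by rewrite u20 mul0r mulr1 addr0 -[u1]opprK u10 oppr0.
case: du1 => [d10|u10]; case: du2 => [d20|u20].
- by move: det0; rewrite d10 d20 !mul0r subrr eqxx.
- move: det0; rewrite d10 mul0r sub0r oppr_eq0 mulf_eq0 => /norP [d2n u1n].
  (* Antidiagonal case: these points kill the words [ddu], [dud], [duu], [udu] of the relations but
     not [uud], to which the leading word [DDU] is now proportional. *)
  have /= := lin (fun i => nth 0 [:: 0; 0; 1] i) (fun i => nth 0 [:: 1; 1; 0] i).
  move=> /(_ ltac:(ring)) /(_ ltac:(ring)).
  rewrite d10 u20 !(mulr0, mul0r, mulr1, addr0, add0r) => /eqP.
  by rewrite !mulf_eq0 (negPf d2n) (negPf u1n).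
- move: det0; rewrite d20 mul0r subr0 mulf_eq0 => /norP [d1n u2n].
  (* Diagonal case: the points [(1, 1/a')], [(1, 1)], [(1, a')] satisfy the relations for [a']. The
     convention [0^-1 = 0] covers [a' = 0]. *)
  have a'V : 1 * 1 * a' = a' * (a'^-1 * 1 * a').
    by have [->|a'0] := eqVneq a' 0; [rewrite mul0r mulr0 | rewrite !mulr1 mulVf // mul1r mulr1].
  have /= := lin (fun=> 1) (fun i => nth 0 [:: a'^-1; 1; a'] i).
  move=> /(_ ltac:(ring)) /(_ a'V).
  rewrite d20 u10 !(mulr0, mul0r, mulr1, addr0, add0r) => e.
  apply: (mulfI (mulf_neq0 (mulf_neq0 d1n d1n) u2n)).
  by rewrite -mulrA e; ring.
- by move: det0; rewrite u10 u20 !mulr0 subrr eqxx.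
Qed.

(** * The Toeplitz representation *)

(** The endomorphisms of the vector space [K[X]], to be made an [algType] under composition so that
    homomorphisms can be tested on an infinite-dimensional representation. *)
Record polyend (K : fieldType) := Polyend {
  polyend_fun :> {poly K} -> {poly K};
  polyend_linear : linear polyend_fun
}.

HB.instance Definition _ (K : fieldType) (f : polyend K) :=
  GRing.isLinear.Build K {poly K} {poly K} *:%R (polyend_fun K f) (polyend_linear K f).

Lemma polyendP (K : fieldType) (f g : polyend K) : f =1 g -> f = g.
Proof.
case: f g => [f hf] [g hg] /= /funext e; subst g.
by rewrite (Prop_irrelevance hf hg).
Qed.

HB.instance Definition _ (K : fieldType) := gen_eqMixin (polyend K).
HB.instance Definition _ (K : fieldType) := gen_choiceMixin (polyend K).

Definition polyend_of (K : fieldType) (f : {linear {poly K} -> {poly K}}) : polyend K :=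
  Polyend K f (@linearP _ _ _ _ f).

Fact pe_zero_linear (K : fieldType) : linear ((fun=> 0) : {poly K} -> {poly K}).
Proof. by move=> c p q; rewrite scaler0 addr0. Qed.
Fact pe_opp_linear (K : fieldType) (f : polyend K) : linear (fun p : {poly K} => - f p).
Proof. by move=> c p q; rewrite linearP opprD scalerN. Qed.
Fact pe_add_linear (K : fieldType) (f g : polyend K) : linear (fun p : {poly K} => f p + g p).
Proof. by move=> c p q; rewrite !linearP scalerDr addrACA. Qed.
Fact pe_one_linear (K : fieldType) : linear (@id {poly K}).
Proof. by []. Qed.
Fact pe_mul_linear (K : fieldType) (f g : polyend K) : linear (fun p : {poly K} => f (g p)).
Proof. by move=> c p q; rewrite !linearP. Qed.
Fact pe_scale_linear (K : fieldType) (k : K) (f : polyend K) : linear (fun p : {poly K} => k *: f p).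
Proof. by move=> c p q; rewrite linearP scalerDr !scalerA mulrC. Qed.

Definition pe_zero K := Polyend K _ (pe_zero_linear K).
Definition pe_opp K f := Polyend K _ (pe_opp_linear K f).
Definition pe_add K f g := Polyend K _ (pe_add_linear K f g).
Definition pe_one K := Polyend K _ (pe_one_linear K).
Definition pe_mul K f g := Polyend K _ (pe_mul_linear K f g).
Definition pe_scale K k f := Polyend K _ (pe_scale_linear K k f).

Fact pe_addA K : associative (pe_add K).
Proof. by move=> f g h; apply: polyendP => p /=; rewrite addrA. Qed.
Fact pe_addC K : commutative (pe_add K).
Proof. by move=> f g; apply: polyendP => p /=; rewrite addrC. Qed.
Fact pe_add0 K : left_id (pe_zero K) (pe_add K).
Proof. by move=> f; apply: polyendP => p /=; rewrite add0r. Qed.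
Fact pe_addN K : left_inverse (pe_zero K) (pe_opp K) (pe_add K).
Proof. by move=> f; apply: polyendP => p /=; rewrite addNr. Qed.
HB.instance Definition _ (K : fieldType) :=
  GRing.isZmodule.Build (polyend K) (pe_addA K) (pe_addC K) (pe_add0 K) (pe_addN K).

Fact pe_mulA K : associative (pe_mul K).
Proof. by move=> f g h; apply: polyendP. Qed.
Fact pe_mul1 K : left_id (pe_one K) (pe_mul K).
Proof. by move=> f; apply: polyendP. Qed.
Fact pe_mulr1 K : right_id (pe_one K) (pe_mul K).
Proof. by move=> f; apply: polyendP. Qed.
Fact pe_mulDl K : left_distributive (pe_mul K) +%R.
Proof. by move=> f g h; apply: polyendP. Qed.
Fact pe_mulDr K : right_distributive (pe_mul K) +%R.
Proof. by move=> f g h; apply: polyendP => p /=; rewrite linearD. Qed.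
Fact pe_one_neq0 K : pe_one K != 0.
Proof.
by apply/eqP => /(congr1 (fun f : polyend K => f 1)) /= /eqP; rewrite oner_eq0.
Qed.
HB.instance Definition _ (K : fieldType) := GRing.Zmodule_isNzRing.Build (polyend K)
  (pe_mulA K) (pe_mul1 K) (pe_mulr1 K) (pe_mulDl K) (pe_mulDr K) (pe_one_neq0 K).

Fact pe_scaleA K a b f : pe_scale K a (pe_scale K b f) = pe_scale K (a * b) f.
Proof. by apply: polyendP => p /=; rewrite scalerA. Qed.
Fact pe_scale1 K : left_id 1 (pe_scale K).
Proof. by move=> f; apply: polyendP => p /=; rewrite scale1r. Qed.
Fact pe_scaleDr K : right_distributive (pe_scale K) +%R.
Proof. by move=> c f g; apply: polyendP => p /=; rewrite scalerDr. Qed.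
Fact pe_scaleDl K f : {morph (pe_scale K)^~ f : a b / a + b}.
Proof. by move=> a b; apply: polyendP => p /=; rewrite scalerDl. Qed.
HB.instance Definition _ (K : fieldType) := GRing.Zmodule_isLmodule.Build K (polyend K)
  (pe_scaleA K) (pe_scale1 K) (pe_scaleDr K) (pe_scaleDl K).

Fact pe_scaleAl (K : fieldType) (a : K) (f g : polyend K) : a *: (f * g) = (a *: f) * g.
Proof. by apply: polyendP. Qed.
HB.instance Definition _ (K : fieldType) := GRing.Lmodule_isLalgebra.Build K (polyend K)
  (@pe_scaleAl K).
Fact pe_scaleAr (K : fieldType) (a : K) (f g : polyend K) : a *: (f * g) = f * (a *: g).
Proof. by apply: polyendP => p /=; rewrite linearZ. Qed.
HB.instance Definition _ (K : fieldType) := GRing.Lalgebra_isAlgebra.Build K (polyend K)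
  (@pe_scaleAr K).

Definition toep_u (K : fieldType) : polyend K := polyend_of K ('X \*o idfun).
Definition toep_d (K : fieldType) (c : K) : polyend K := c *: polyend_of K (drop_poly 1).

Lemma toep_du (K : fieldType) (c : K) : toep_d K c * toep_u K = c%:A.
Proof.
apply: polyendP => p; rewrite -[LHS]/(c *: drop_poly 1 ('X * p)) -[RHS]/(c *: p).
by rewrite mulrC -['X]expr1 drop_polyMXn_id.
Qed.

Lemma toep_rel (K : fieldType) (a g : K) : a != 1 ->
  downup_rel a 0 g (toep_d K (g / (1 - a))) (toep_u K).
Proof.
(* Since [d u] is the scalar [c], both relations reduce to [c = a c + g]. *)
move=> a1; have a1' : 1 - a != 0 by rewrite subr_eq0 eq_sym.
set c := g / (1 - a); have ec : c = a * c + g by rewrite /c; field.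
move: (toep_d K c) (toep_u K) (toep_du K c) => d u du; split.
  by rewrite -mulrA !du mulr_algl mulr_algr scale0r addr0 scalerA -scalerDl -ec.
by rewrite -[u * d * u]mulrA !du mulr_algl mulr_algr scale0r addr0 scalerA -scalerDl -ec.
Qed.

(* Modulo finite rank, [t] acts on the Toeplitz module as multiplication by the
   Laurent polynomial [q / X^N], which also gives the values of [t] on the hyperbola. *)
Lemma toep_symbol (K : fieldType) (c : K) (t : dterm K) :
  exists N q, (forall n p, deval (toep_d K c) (toep_u K) t (p * 'X^(n + N)) = p * q * 'X^n) /\
    forall x : K, x != 0 -> deval (c / x : K^o) x t * x ^+ N = q.[x].
Proof.
elim: t => [k|||s [N1 [q1 [h1 e1]]] t [N2 [q2 [h2 e2]]]|s [N1 [q1 [h1 e1]]] t [N2 [q2 [h2 e2]]]].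
- exists 0, k%:P; split=> [n p|x x0] /=; last by rewrite hornerC [k%:A]mulr1 mulr1.
  by rewrite addn0 [LHS]/(k *: _) -mulrA mulrCA mul_polyC.
- exists 1, c%:P; split=> [n p|x x0] /=; last by rewrite hornerC divfK.
  by rewrite -[LHS]/(c *: drop_poly 1 (p * 'X^(n + 1))) exprD mulrA drop_polyMXn_id -mulrA mulrCA mul_polyC.
- exists 0, 'X; split=> [n p|x x0] /=; last by rewrite hornerX mulr1.
  by rewrite -[LHS]/('X * (p * 'X^(n + 0))) addn0 mulrCA mulrA.
- exists (N1 + N2), (q1 * 'X^N2 + q2 * 'X^N1); split=> [n p|x x0]; last first.
    rewrite [deval _ _ _]/= hornerD !hornerM !hornerXn -e1 // -e2 // exprD; ring.
  pose f : polyend K := deval (toep_d K c) (toep_u K) s.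
  pose g : polyend K := deval (toep_d K c) (toep_u K) t.
  rewrite -[LHS]/(f (p * 'X^(n + (N1 + N2))) + g (p * 'X^(n + (N1 + N2)))).
  rewrite {1}[(N1 + N2)%N]addnC !addnA /f h1 /g h2 !exprD; ring.
- exists (N1 + N2), (q1 * q2); split=> [n p|x x0]; last first.
    rewrite [deval _ _ _]/= hornerM -e1 // -e2 // exprD; ring.
  pose f : polyend K := deval (toep_d K c) (toep_u K) s.
  pose g : polyend K := deval (toep_d K c) (toep_u K) t.
  rewrite -[LHS]/(f (g (p * 'X^(n + (N1 + N2))))) addnA /g h2 /f h1; ring.
Qed.

(** Matrices act on row vectors, with [E] in the role of an inclusion. Modulo the rows of [Q *m E],
    the matrix [d] is onto and only a complement of the rows of [Q] contributes to its image; hence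
    [m + 1] is at most [\rank Q + (m - \rank Q)], that is [m]. *)
Lemma index_obstruction (K : fieldType) (c : K) (m : nat) (d E : 'M[K]_(m, m.+1))
    (u Q : 'M[K]_(m.+1, m)) :
  c != 0 -> u *m d = c%:M + Q *m E -> (Q *m d <= Q *m E)%MS -> False.
Proof.
move=> c0 ud Qd.
have full : (1%:M <= Q *m E + Q^C%MS *m d)%MS.
  have dsub : (d <= Q *m E + Q^C%MS *m d)%MS.
    rewrite -[X in (X <= _)%MS]mul1mx.
    apply: submx_trans (_ : (_ <= (Q + Q^C)%MS *m d)%MS) _.
      by apply: submxMr; rewrite submx_full // addsmx_compl_full.
    by rewrite addsmxMr addsmxS.
  have -> : 1%:M = c^-1 *: (u *m d - Q *m E) :> 'M_m.+1.
    by rewrite ud addrK scale_scalar_mx mulVf.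
  rewrite scalemx_sub // addmx_sub ?eqmx_opp ?addsmxSl //.
  exact: submx_trans (submxMl _ _) dsub.
have := mxrankS full; rewrite mxrank1 leqNgt => /negP; apply.
apply: leq_ltn_trans (mxrank_adds_leqif _ _) _.
rewrite ltnS; apply: (@leq_trans (\rank Q + (m - \rank Q))); last by rewrite subnKC // rank_leq_col.
by rewrite leq_add ?mxrankM_maxl // -mxrank_compl mxrankM_maxl.
Qed.

Lemma linear_bounded (K : fieldType) (f : {linear {poly K} -> {poly K}}) (N : nat) :
  exists B, forall p : {poly K}, (size p <= N)%N -> (size (f p) <= B)%N.
Proof.
exists (\max_(i < N) size (f 'X^i)) => p pN.
have -> : p = \sum_(i < N) p`_i *: 'X^i.
  rewrite -[LHS](take_poly_id pN) /take_poly poly_def.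
  exact.
rewrite linear_sum; apply: leq_trans (size_sum _ _ _) _; apply/bigmax_leqP => i _.
rewrite linearZ; apply: leq_trans (size_scale_leq _ _) _.
exact: (leq_bigmax i).
Qed.

Lemma size_mulXn_leq (K : fieldType) (c : K) (p : {poly K}) (n m : nat) :
  (size p + n <= m)%N -> (size (c *: (p * 'X^n)) <= m)%N.
Proof.
move=> h; apply: leq_trans (size_scale_leq _ _) _; apply: leq_trans (size_polyMleq _ _) _.
by rewrite size_polyXn addnS.
Qed.

(* If [D] shifts degrees up and [U] down, [D U - c] has finite-dimensional image
   [F], which [D] stabilises; modulo [F], [D] would be a surjection from the
   polynomials of degree [< m] onto those of degree [< m + 1]. *)
Lemma no_reversed_shift (K : fieldType) (a c g la mu : K) (N : nat)
    (D U : {linear {poly K} -> {poly K}}) :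
  c != 0 -> la * mu = c -> c = a * c + g ->
  (forall p, D (p * 'X^N) = la *: (p * 'X^(N.+1))) ->
  (forall p, U (p * 'X^(N.+1)) = mu *: (p * 'X^N)) ->
  (forall p, D (D (U p)) = a *: D (U (D p)) + g *: D p) -> False.
Proof.
move=> c0 lamu ec hD hU rel.
pose P : {linear {poly K} -> {poly K}} := (D \o U) \- (c \*: idfun).
have PE p : P p = D (U p) - c *: p by [].
have P0 p : P (p * 'X^(N.+1)) = 0.
  by rewrite PE hU linearZ /= hD scalerA mulrC lamu subrr.
(* This commutation makes the image of [P] stable under [D]. *)
have DP p : D (P p) = a *: P (D p).
  rewrite !PE linearB linearZ /= rel scalerBr scalerA -addrA; congr (_ + _).
  by rewrite {1}ec scalerDl opprD addrCA subrr addr0.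
have Ptake p : P p = P (take_poly N.+1 p).
  by rewrite -[in LHS](poly_take_drop N.+1 p) linearD P0 addr0.
clearbody P.
have [BD bD] := linear_bounded K D N; have [BU bU] := linear_bounded K U N.+1.
have [BP bP] := linear_bounded K P N.+1.
(* Large enough for the parts of [D], [U] and [P] not given by shifts to stay within the size bounds
   below. *)
pose m := (BD + BU + BP + N.+1)%N.
have sD (p : {poly K}) : (size p <= m)%N -> (size (D p) <= m.+1)%N.
  move=> pm; rewrite -(poly_take_drop N p) linearD hD.
  apply: leq_trans (size_polyD _ _) _; rewrite geq_max; apply/andP; split.
    by apply: leq_trans (bD _ (size_take_poly _ _)) _; rewrite /m; lia.
  by apply: size_mulXn_leq; rewrite size_drop_poly; move: pm; rewrite /m; lia.
have sU (p : {poly K}) : (size p <= m.+1)%N -> (size (U p) <= m)%N.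
  move=> pm; rewrite -(poly_take_drop N.+1 p) linearD hU.
  apply: leq_trans (size_polyD _ _) _; rewrite geq_max; apply/andP; split.
    by apply: leq_trans (bU _ (size_take_poly _ _)) _; rewrite /m; lia.
  by apply: size_mulXn_leq; rewrite size_drop_poly; move: pm; rewrite /m; lia.
have sP (p : {poly K}) : (size (P p) <= m)%N.
  by rewrite Ptake; apply: leq_trans (bP _ (size_take_poly _ _)) _; rewrite /m; lia.
pose mx n n' (f : {linear {poly K} -> {poly K}}) : 'M[K]_(n, n') :=
  lin1_mx (poly_rV \o f \o rVpoly).
have mxmulE n n' f (v : 'rV_n) : v *m mx n n' f = poly_rV (f (rVpoly v)).
  by rewrite mul_rV_lin1.
have sz n (v : 'rV[K]_n) : (size (rVpoly v) <= n)%N by exact: size_poly.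
pose E := mx m m.+1 idfun; pose Q := mx m.+1 m P.
apply: (index_obstruction K c m (mx m m.+1 D) E (mx m.+1 m U) Q c0).
  apply/row_matrixP => i; rewrite !rowE mulmxDr !mulmxA !mxmulE /=.
  rewrite !poly_rV_K ?sP ?sU ?sz // PE linearB linearZ /= rVpolyK.
  by rewrite mul_mx_scalar addrC subrK.
apply/row_subP => i; rewrite rowE mulmxA !mxmulE poly_rV_K // DP -linearZ Ptake.
(* The polynomial [a *: D p] may have size [m + 2], but [P] sees only its lowest [N + 1]
   coefficients. *)
set w := take_poly _ _.
have sw : (size w <= m.+1)%N.
  by apply: leq_trans (size_take_poly _ _) _; rewrite /m; lia.
have <- : poly_rV w *m (Q *m E) = poly_rV (P w) by rewrite mulmxA !mxmulE !poly_rV_K.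
exact: submxMl.
Qed.

(** * The hyperbola *)

Lemma natr_inj_pchar0 (K : fieldType) : [pchar K] =i pred0 -> injective (fun n => n%:R : K).
Proof.
move=> /pcharf0P hK.
suff le m n : (m <= n)%N -> m%:R = n%:R :> K -> m = n.
  by move=> m n e; case: (leqP m n) => [|/ltnW] h; [exact: le | exact/esym/(le _ _ h)].
move=> mn e; apply/eqP; rewrite eqn_leq mn -subn_eq0 -hK natrB //.
by rewrite e subrr eqxx.
Qed.

Lemma poly_eq0_nonzero (K : fieldType) (p : {poly K}) : [pchar K] =i pred0 ->
  (forall x, x != 0 -> p.[x] = 0) -> p = 0.
Proof.
move=> hK p0; pose s := [seq i.+1%:R : K | i <- iota 0 (size p)].
apply: (@roots_geq_poly_eq0 _ p s); last by rewrite size_map size_iota.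
  apply/allP => _ /mapP [i _ ->]; apply/rootP/p0.
  by rewrite ((pcharf0P K).1 hK).
rewrite map_inj_uniq ?iota_uniq // => i j /(natr_inj_pchar0 K hK) [].
exact.
Qed.

Lemma dvdp_Xn_monomial (K : fieldType) (p : {poly K}) (n : nat) :
  p %| 'X^n -> exists i b, b != 0 /\ p = b *: 'X^i.
Proof.
rewrite -[X in X ^+ n]subr0 -[0]/(polyC 0) => /dvdp_exp_XsubCP [i _].
rewrite subr0 => /eqpf_eq [b b0 ->]; by exists i, b.
Qed.

(* The image of the hyperbola of [A(a', 0, g')] is the hyperbola of [A(a, 0, g)],
   on which [D] and [U] are mutually inverse up to a constant, hence monomials. *)
Lemma hyperbola_monomial (K : fieldType) (hK : [pchar K] =i pred0) (a g a' g' : K)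
    (D U D' U' : dterm K) :
  g != 0 -> a != 1 -> a' != 1 ->
  downup_hom a 0 g a' 0 g' D U ->
  (forall (R : algType K) (x y : R), downup_rel a' 0 g' x y ->
     deval (deval x y D) (deval x y U) U' = y) ->
  let c' := g' / (1 - a') in
  exists N i j la mu, [/\ la * mu = g / (1 - a), (i + j = N + N)%N,
    forall p n, deval (toep_d K c') (toep_u K) D (p * 'X^(n + N)) = la *: (p * 'X^(n + j)),
    forall p n, deval (toep_d K c') (toep_u K) U (p * 'X^(n + N)) = mu *: (p * 'X^(n + i)) &
    forall x : K, x != 0 -> deval (c' / x : K^o) x D * x ^+ N = la * x ^+ j /\
       deval (c' / x : K^o) x U * x ^+ N = mu * x ^+ i].
Proof.
move=> g0 a1 a1' h h'K c'.
have a10 : 1 - a != 0 by rewrite subr_eq0 eq_sym.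
set c := g / (1 - a); have c0 : c != 0 by rewrite mulf_neq0 ?invr_neq0.
have [N1 [q1 [hq1 eq1]]] := toep_symbol K c' D.
have [N2 [q2 [hq2 eq2]]] := toep_symbol K c' U.
have rel x (x0 : x != 0) := h _ _ _ (@downup_rel_hyperbola K a' g' x a1' x0).
have q120 : q1 * (q1 * q2 - c *: 'X^(N1 + N2)) = 0.
  apply: (poly_eq0_nonzero K _ hK) => x x0.
  have /downup_rel_scal [+ _] := rel x x0; rewrite -/c' => e.
  rewrite hornerM hornerD hornerN hornerM hornerZ hornerXn -eq1 // -eq2 //.
  set Dx := deval _ _ D in e *; set Ux := deval _ _ U in e *.
  have -> : Dx * x ^+ N1 * (Dx * x ^+ N1 * (Ux * x ^+ N2) - c * x ^+ (N1 + N2)) =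
    Dx * ((1 - a) * (Dx * Ux) - g) * (x ^+ N1 * x ^+ N1 * x ^+ N2 / (1 - a)).
    by rewrite /c exprD; field.
  by rewrite [Dx * _]e mul0r.
(* If [D] vanished on the hyperbola, so would [U] because [g != 0]; then [U'] would take a constant
   value yet return every nonzero [x]. *)
have q10 : q1 != 0.
  apply: contraTneq isT => q10.
  have Dx0 x : x != 0 -> deval (c' / x : K^o) x D = 0.
    move=> x0; apply/eqP; have := eq1 x x0; rewrite q10 horner0 => /eqP.
    by rewrite mulf_eq0 expf_eq0 (negPf x0) andbF orbF.
  have Ux0 x : x != 0 -> deval (c' / x : K^o) x U = 0.
    move=> x0; have /downup_rel_scal [_] := rel x x0; rewrite -/c' Dx0 // mul0r mulr0 sub0r.
    by move/eqP; rewrite mulf_eq0 oppr_eq0 (negPf g0) orbF => /eqP.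
  have cst x : x != 0 -> deval (0 : K^o) 0 U' = x.
    move=> x0; have := h'K _ _ _ (@downup_rel_hyperbola K a' g' x a1' x0).
    by rewrite -/c' Dx0 // Ux0.
  have two0 : 2 != 0 :> K by rewrite ((pcharf0P K).1 hK).
  have e12 : 1 = 2 :> K := etrans (esym (cst 1 (oner_neq0 K))) (cst 2 two0).
  by have := natr_inj_pchar0 K hK 1 2 e12.
move: q120 => /eqP; rewrite mulf_eq0 (negPf q10) subr_eq0 => /eqP q12.
have [|i [mu [mu0 q2E]]] := dvdp_Xn_monomial K q2 (N1 + N2).
  by rewrite -(dvdpZr _ _ c0) -q12 dvdp_mull.
have [|j [la [la0 q1E]]] := dvdp_Xn_monomial K q1 (N1 + N2).
  by rewrite -(dvdpZr _ _ c0) -q12 dvdp_mulr.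
move: q12; rewrite q1E q2E -scalerAl -scalerAr scalerA -exprD => e.
have ij : (j + i = N1 + N2)%N.
  move/(congr1 (fun p : {poly K} => size p)): e => /=.
  by rewrite (size_scale _ (mulf_neq0 la0 mu0)) (size_scale _ c0) !size_polyXn => -[].
have lamu : la * mu = c.
  move/(congr1 (fun p : {poly K} => p`_(j + i))): e => /=.
  by rewrite !coefZ !coefXn -ij eqxx !mulr1.
(* Both Laurent monomials are brought to the common denominator ['X^(N1 + N2)]. *)
exists (N1 + N2)%N, (i + N1)%N, (j + N2)%N, la, mu; split=> //.
- by rewrite addnACA [(i + j)%N]addnC ij.
- move=> p n; rewrite [(N1 + N2)%N]addnC addnA hq1 q1E -scalerAr -scalerAl -mulrA -exprD.
  by rewrite addnCA.
- move=> p n; rewrite addnA hq2 q2E -scalerAr -scalerAl -mulrA -exprD.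
  by rewrite addnCA.
- move=> x x0; split.
    by rewrite exprD mulrA eq1 // q1E hornerZ hornerXn -mulrA -exprD.
  by rewrite [(N1 + N2)%N]addnC exprD mulrA eq2 // q2E hornerZ hornerXn -mulrA -exprD.
Qed.

Lemma deval_comm (K : fieldType) (R : algType K) (x y : R) (s t : dterm K) :
  x * y = y * x -> deval x y s * deval x y t = deval x y t * deval x y s.
Proof.
move=> xy.
have comm z : GRing.comm z x -> GRing.comm z y -> forall t, GRing.comm z (deval x y t).
  move=> zx zy; elim=> [c|||s' IHs t' IHt|s' IHs t' IHt] //=.
  - by rewrite /GRing.comm mulr_algl mulr_algr.
  - exact: commrD.
  - exact: commrM.
by apply: (comm); apply/commr_sym; apply: (comm).
Qed.

(** The quotient by [w] is a quantum Weyl algebra, so its modules supply representations. *)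
Lemma downup_rel_weyl (K : fieldType) (R : algType K) (a g : K) (x y : R) :
  x * y = a *: (y * x) + g%:A -> downup_rel a 0 g x y.
Proof.
move=> e; rewrite /downup_rel !scale0r !addr0; split.
  by rewrite -mulrA {1}e mulrDr -scalerAr mulrA mulr_algr.
by rewrite {1}e mulrDl -scalerAl mulr_algl.
Qed.

(* Two points of the hyperbola have a non-split extension exactly when their
   [u]-coordinates have ratio [a']. *)
Lemma hyperbola_extension (K : fieldType) (a g a' g' la mu : K) (D U D' U' : dterm K) :
  g' != 0 -> a != 1 -> a' != 1 -> a' != 0 -> la != 0 -> la * mu = g / (1 - a) ->
  downup_hom a 0 g a' 0 g' D U ->
  (forall (R : algType K) (x y : R), downup_rel a' 0 g' x y ->
     deval (deval x y D) (deval x y U) D' = x /\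
     deval (deval x y D) (deval x y U) U' = y) ->
  let c' := g' / (1 - a') in
  (forall x : K, x != 0 -> deval (c' / x : K^o) x D = la / x /\
                           deval (c' / x : K^o) x U = mu * x) ->
  a' = a.
Proof.
move=> g0 a1 a1' a0' la0 lamu h h'K c' hyp.
have a10 : 1 - a != 0 by rewrite subr_eq0 eq_sym.
have a10' : 1 - a' != 0 by rewrite subr_eq0 eq_sym.
pose i0 : 'I_2 := ord0; pose i1 : 'I_2 := ord_max.
have mul01 (M N : 'M[K]_2) : (M * N) i0 i1 = M i0 i0 * N i0 i1 + M i0 i1 * N i1 i1.
  rewrite mxE big_ord_recl big_ord1; congr (_ + M i0 _ * N _ i1); exact/val_inj.
have mul11 (M N : 'M[K]_2) : depth K 2 0 M -> depth K 2 0 N -> (M * N) i1 i1 = M i1 i1 * N i1 i1.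
  by move=> hM hN; rewrite [LHS](depth_mulE K 2 0 0 M N i1 i1 i1).
have mul00 (M N : 'M[K]_2) : depth K 2 0 M -> depth K 2 0 N -> (M * N) i0 i0 = M i0 i0 * N i0 i0.
  by move=> hM hN; rewrite [LHS](depth_mulE K 2 0 0 M N i0 i0 i0).
have ord2 (i : 'I_2) : i = i0 \/ i = i1.
  by case: i => [[|[|//]] h2]; [left | right]; apply: val_inj.
(* An extension between the points of the hyperbola with [u]-coordinates [1] and [a']. *)
pose x : 'M[K]_2 := \matrix_(i, j) if i == j then if i == i0 then c' else c' / a' else 0.
pose y : 'M[K]_2 := \matrix_(i, j) if i == i0 then 1 else if j == i0 then 0 else a'.
have dx : depth K 2 0 x.
  by move=> i j; case: (ord2 i) => ->; case: (ord2 j) => ->; rewrite // mxE.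
have dy : depth K 2 0 y.
  by move=> i j; case: (ord2 i) => ->; case: (ord2 j) => ->; rewrite // mxE.
have weyl : x * y = a' *: (y * x) + g'%:A.
  have -> : g'%:A = g'%:M :> 'M[K]_2 by exact: scalemx1.
  apply/matrixP => i j; rewrite !mxE !big_ord_recl !big_ord0 !mxE.
  case: (ord2 i) => ->; case: (ord2 j) => ->; rewrite /= /c';
    by field; rewrite ?a0' ?a10'.
have xy := downup_rel_weyl K _ a' g' x y weyl.
have [dM eM] := deval_depth0 K _ x y D dx dy.
have [dN eN] := deval_depth0 K _ x y U dx dy.
have [xM yN] := h'K _ x y xy.
have [+ _] := h _ _ _ xy.
move: (eM i0) (eM i1) (eN i0) (eN i1) dM dN xM yN; rewrite !mxE /=.
have [D0 U0] := hyp 1 (oner_neq0 K); have [D1 U1] := hyp a' a0'.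
rewrite divr1 in D0 U0; rewrite D0 U0 D1 U1 mulr1 divr1.
set M := deval x y D; set N := deval x y U => M0 M1 N0 N1 dM dN xM yN e.
(* Commuting [M], [N] would make [x] and [y] commute, as these are recovered through [D'] and [U'];
   but the extension is not split. *)
have comm01 : M * N = N * M -> False.
  move=> MN; have := deval_comm K _ _ _ D' U' MN; rewrite xM yN => /matrixP /(_ i0 i1).
  rewrite !mul01 !mxE /= => cc; have : (a' - 1) * c' = 0.
    have -> : (a' - 1) * c' = a' * (c' * 1 + 0 * a' - (1 * 0 + 1 * (c' / a'))) by field.
    by rewrite cc subrr mulr0.
  move/eqP; rewrite !mulf_eq0 subr_eq0 invr_eq0.
  by rewrite (negPf a1') (negPf g0) (negPf a10').
move/matrixP: e => /(_ i0 i1).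
rewrite scale0r addr0 [in RHS]mxE [in X in X + _]mxE [in X in _ + X]mxE !mul01 !mul00 // M0 M1 N0 N1.
set E := M i0 i1; set F := N i0 i1.
have -> : g = (1 - a) * (la * mu) by rewrite lamu mulrC divfK.
move=> e.
(* The corner entry of the first relation factors, and [a' - 1] times its last factor is the corner
   entry of [M * N - N * M]. *)
have : la * (a' - a) * (la * F / a' + mu * E) = 0.
  move/eqP: e; rewrite -subr_eq0 => /eqP e; rewrite -[RHS]e; field; exact: a0'.
move/eqP; rewrite !mulf_eq0 (negPf la0) subr_eq0 /= => /orP [/eqP //|/eqP z].
case: comm01; apply/matrixP => i j; case: (ord2 i) => ->; case: (ord2 j) => ->.
- by rewrite !mul00 // mulrC.
- rewrite !mul01 M0 M1 N0 N1 -/E -/F; apply/eqP; rewrite -subr_eq0.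
  have -> : la * F + E * (mu * a') - (mu * E + F * (la / a')) = (a' - 1) * (la * F / a' + mu * E).
    by field.
  by rewrite z mulr0.
- by rewrite (depth_mul K 2 0 0 M N) // (depth_mul K 2 0 0 N M).
- by rewrite !mul11 // mulrC.
Qed.

Lemma iso_alpha_gamma_neq0 (K : fieldType) (hK : [pchar K] =i pred0) (a a' g g' : K) :
  g != 0 -> g' != 0 -> a != 1 -> a' != 1 -> a' != 0 ->
  downup_iso a 0 g a' 0 g' -> a' = a.
Proof.
move=> g0 g0' a1 a1' a0' [D [U [D' [U' [h h' hinv hinv']]]]].
have a10 : 1 - a != 0 by rewrite subr_eq0 eq_sym.
set c := g / (1 - a); have c0 : c != 0 by rewrite mulf_neq0 ?invr_neq0.
have [N [i [j [la [mu [lamu ij hD hU ev]]]]]] := hyperbola_monomial K hK a g a' g' D U D' U'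
  g0 a1 a1' h (fun R x y r => (hinv' R x y r).2).
have [N' [i' [j' [la' [mu' [_ _ _ _ ev']]]]]] := hyperbola_monomial K hK a' g' a g D' U' D U
  g0' a1' a1 h' (fun R x y r => (hinv R x y r).2).
have [la0 mu0] : la != 0 /\ mu != 0.
  by move: c0; rewrite /c -lamu mulf_eq0 negb_or => /andP.
set c' := g' / (1 - a') in hD hU ev ev'.
pose k : int := i%:Z - N%:Z; pose k' : int := i'%:Z - N'%:Z.
have evU (x : K) : x != 0 -> deval (c' / x : K^o) x U = mu * x ^ k.
  move=> x0; have [_ e] := ev x x0; apply: (mulIf (expf_neq0 N x0)).
  by rewrite e -mulrA !exprnP -expfzDr // subrK.
have evD (x : K) : x != 0 -> deval (c' / x : K^o) x D = c / deval (c' / x : K^o) x U.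
  move=> x0; have [e e'] := ev x x0.
  set u := deval _ _ U in e' *.
  have u0 : u != 0.
    by apply: contra_eq_neq e' => ->; rewrite mul0r eq_sym mulf_neq0 ?expf_neq0.
  apply: (mulIf u0); rewrite divfK //; apply: (mulIf (expf_neq0 (N + N)%N x0)).
  by rewrite exprD mulrACA e e' mulrACA lamu -!exprD addnC ij.
have evU' (x : K) : x != 0 -> deval (c / x : K^o) x U' = mu' * x ^ k'.
  move=> x0; have [_ e] := ev' x x0; apply: (mulIf (expf_neq0 N' x0)).
  by rewrite e -mulrA !exprnP -expfzDr // subrK.
(* On [u]-coordinates the two isomorphisms are [x |-> mu x^k] and [x |-> mu' x^k']; since they
   compose to the identity, [k k' = 1], which is checked at [x = 1] and [x = 2]. *)
have comp (x : K) : x != 0 -> mu' * mu ^ k' * x ^ (k * k') = x.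
  move=> x0; have [_] := hinv' _ _ _ (@downup_rel_hyperbola K a' g' x a1' x0).
  rewrite -/c' evD // evU // evU' ?mulf_neq0 ?expfz_neq0 //.
  by rewrite expfzMl exprz_exp mulrA.
have kk : k * k' = 1.
  have two0 n : n.+1%:R != 0 :> K by rewrite ((pcharf0P K).1 hK).
  have := comp 1 (oner_neq0 K); rewrite exp1rz mulr1 => e1.
  have := comp 2 (two0 1%N); rewrite e1 mul1r => e2.
  have {}e2 : 2 ^ (k * k' - 1) = 1 :> K.
    by rewrite expfzDr ?two0 // e2 exprN1 divff ?two0.
  have pow2 m : 2 ^+ m = 1 :> K -> m = 0%N.
    rewrite -natrX => /(natr_inj_pchar0 K hK _ 1) /eqP.
    by case: m => // m; rewrite expnS muln_eq1.
  apply/eqP; rewrite -subr_eq0; move: (k * k' - 1) e2 => [m /pow2 -> //|m].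
  by rewrite -[_ ^ _]/((2 ^+ m.+1)^-1) => /eqP; rewrite invr_eq1 => /eqP /pow2.
have [k1|k1] : k = 1 \/ k = -1.
  have : (`|k| * `|k'| == 1)%N by rewrite -abszM kk.
  by rewrite muln_eq1 => /andP [/eqP + _]; lia.
- apply: (hyperbola_extension K a g a' g' la mu D U D' U') => //; rewrite -/c'.
  move=> x x0.
  rewrite evD // evU // k1 expr1z; split=> //.
  by rewrite -[c]lamu; field; rewrite mu0 x0.
(* Here [D] shifts degrees up by one and [U] down by one, up to finite rank: the reverse of [d] and
   [u]. *)
- have [iN jN] : (N = i.+1 /\ j = N.+1)%N.
    by move: k1 ij; rewrite /k; lia.
  have [rel _] := h _ _ _ (toep_rel K a' g' a1').
  case: (no_reversed_shift K a c g la mu N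
    (deval (toep_d K c') (toep_u K) D : polyend K) (deval (toep_d K c') (toep_u K) U : polyend K)) => //.
  + by rewrite /c; field.
  + by move=> p; have := hD p 0%N; rewrite !add0n jN.
  + by move=> p; have := hU p 1%N; rewrite !add1n iN.
  + move=> p; move/(congr1 (fun f : polyend K => f p)): rel.
    by rewrite scale0r addr0.
Qed.

(** * Rescaling of [d] and the classification *)

Lemma downup_rel_scale (K : fieldType) (R : algType K) (a g l : K) (x y : R) :
  downup_rel a 0 g x y -> downup_rel a 0 (l * g) (l *: x) y.
Proof.
rewrite /downup_rel !scale0r !addr0 => -[e1 e2].
(* The cubic terms have one more factor [x] than the term in [g], so scaling [x] by [l] scales [g]
   by [l]. *)
split; rewrite -!(scalerAl, scalerAr) -?scalerAl -?scalerAr ?e1 ?e2 !scalerDr !scalerA;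
  by congr (_ *: _ + _ *: _); ring.
Qed.

Theorem theorem1 (K : closedFieldType) (hK : [pchar K] =i pred0)
    (a a' g g' : K) :
  downup_iso a 0 g a' 0 g' <->
  ((exists l : K, l != 0 /\ g = l * g') /\ a' = a).
Proof.
split=> [iso|[[l [l0 ->]] ->]]; last first.
  exists (Tmul (Tc l) Td), Tu, (Tmul (Tc l^-1) Td), Tu.
  split=> R x y; rewrite /= ?mulr_algl => r.
  - exact: downup_rel_scale.
  - by rewrite -[g'](mulKf l0); exact: downup_rel_scale.
  - by rewrite scalerA divff // scale1r.
  - by rewrite scalerA mulVf // scale1r.
have iso' := downup_iso_sym K a 0 g a' 0 g' iso.
have gg' : (g == 0) = (g' == 0).
  by apply/eqP/eqP; [exact: iso_gamma0 iso' | exact: iso_gamma0 iso].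
split.
  have [g'0|g'0] := eqVneq g' 0.
    exists 1; rewrite oner_neq0 mul1r g'0; split=> //.
    by apply/eqP; rewrite gg' g'0.
  exists (g / g'); rewrite mulf_neq0 ?invr_neq0 ?gg' //; split=> //.
  by rewrite divfK.
have [g0|g0] := eqVneq g 0.
  have g'0 : g' = 0 by apply/eqP; rewrite -gg' g0.
  subst g g'.
  have [a1|a1] := eqVneq a' 1; first by rewrite (iso_alpha1_gamma0 K a a' iso a1).
  have [b1|b1] := eqVneq a 1; first by rewrite b1 (iso_alpha1_gamma0 K a' a iso' b1).
  exact: iso_alpha_gamma0 iso.
have g'0 : g' != 0 by rewrite -gg'.
have [a1|a1] := eqVneq a' 1; first by rewrite (iso_alpha1_gamma_neq0 K a a' g g' g'0 iso a1).
have [b1|b1] := eqVneq a 1; first by rewrite b1 (iso_alpha1_gamma_neq0 K a' a g' g g0 iso' b1).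
(* The extension argument divides by [a']; if [a' = 0], it is run with the two algebras exchanged,
   unless [a = 0] as well. *)
have [a0'|a0'] := eqVneq a' 0; last exact: (iso_alpha_gamma_neq0 K hK a a' g g').
have [a0|a0] := eqVneq a 0; first by rewrite a0.
by rewrite (iso_alpha_gamma_neq0 K hK a' a g' g g'0 g0 a1 b1 a0 iso').
Qed.
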